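(* Let $X,Y,Z,W$ be normed spaces, let $f:X\times Y\times Z\to W$ be a bounded tri-linear map, let $w^{*}\in W^{*}$, and let $m:Y\times Z\to X^{*}$ be the bounded bilinear map with $m(y,z)=f^{s*}(w^{*},y,z)$ for every $y\in Y$ and $z\in Z$. If $f$ is close-to-regular, then $m$ is Arens regular.
   Context: Adjoint of a tri-linear map: for a bounded tri-linear map $g:E_1\times E_2\times E_3\to E$ of normed spaces, its adjoint is the bounded tri-linear map $g^{*}:E^{*}\times E_1\times E_2\to E_3^{*}$, $\langle g^{*}(e^{*},e_1,e_2),e_3\rangle=\langle e^{*},g(e_1,e_2,e_3)\rangle$. Iterating four times gives $g^{****}:E_1^{**}\times E_2^{**}\times E_3^{**}\to E^{**}$. Flips: $g^{t}:E_3\times E_1\times E_2\to E$, $g^{t}(e_3,e_1,e_2)=g(e_1,e_2,e_3)$; $g^{s}:E_2\times E_3\times E_1\to E$, $g^{s}(e_2,e_3,e_1)=g(e_1,e_2,e_3)$. Superscripts are applied successively from left to right (e.g. $f^{s*}=(f^{s})^{*}:W^*\times Y\times Z\to X^*$). $f$ is close-to-regular if $f^{t****s}=f^{s****t}$ on $X^{**}\times Y^{**}\times Z^{**}$. Arens regularity of a bilinear map: for a bounded bilinear map $m:E_1\times E_2\to E$ of normed spaces, $m^{*}:E^{*}\times E_1\to E_2^{*}$ is $\langle m^{*}(e^{*},e_1),e_2\rangle=\langle e^{*},m(e_1,e_2)\rangle$, and iterating gives $m^{***}:E_1^{**}\times E_2^{**}\to E^{**}$. With $m^{r}:E_2\times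 E_1\to E$, $m^{r}(e_2,e_1)=m(e_1,e_2)$, one gets $m^{r***r}:E_1^{**}\times E_2^{**}\to E^{**}$. $m$ is Arens regular if $m^{***}=m^{r***r}$. *)

(* Defs.v *)
From HB Require Import structures.
From mathcomp Require Import all_boot all_order all_algebra.
From mathcomp Require Import all_classical all_reals.
From mathcomp Require Import topology normedtype.
From mathcomp Require Import complex.

Set Implicit Arguments.
Unset Strict Implicit.
Unset Printing Implicit Defensive.

Import Order.TTheory GRing.Theory Num.Theory.
Import numFieldNormedType.Exports.

Local Open Scope classical_set_scope.
Local Open Scope ring_scope.

(* The scalars are R or C, treated uniformly: numeric fields in which every
   nonempty bounded set of real elements has a least upper bound.  In a
   numFieldType, x <= y means that y - x is real and nonnegative, so over C the
   condition is the completeness of the copy of R inside C.  Up to isomorphism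
   (Gelfand-Mazur) there are no other models than R and C; both are
   declared as instances below. *)
HB.mixin Record NumField_hasRealSup K & Num.NumField K := {
  real_has_supremums : forall A : set K,
    (forall x, A x -> x \is Num.real) -> has_sup A -> supremums A !=set0
}.

#[short(type="scalarFieldType")]
HB.structure Definition ScalarField :=
  {K of Num.NumField K & NumField_hasRealSup K}.

Section scalar_instances.
Variable R : realType.

Let realType_has_supremums (A : set R) :
  (forall x, A x -> x \is Num.real) -> has_sup A -> supremums A !=set0.
Proof.
move=> _ supA; exists (sup A); split; first exact: ub_le_sup (proj2 supA).
by move=> y yA; exact: ge_sup (proj1 supA) yA.
Qed.

(* harmless: the added field is a proposition *)
#[non_forgetful_inheritance]
HB.instance Definition _ := NumField_hasRealSup.Build R realType_has_supremums.

Let complex_has_supremums (A : set R[i]) :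
  (forall x, A x -> x \is Num.real) -> has_sup A -> supremums A !=set0.
Proof.
move=> Areal [[a Aa] [b bA]].
have ImA x : A x -> complex.Im x = 0.
  by move=> /Areal; case: x => r i; rewrite complex_real => /eqP.
pose B := [set r : R | A (r%:C)%C].
have AB x : A x -> B (complex.Re x).
  by move=> Ax; rewrite /B/=; case: x Ax (ImA _ Ax) => r i /= + i0; rewrite i0.
have supB : has_sup B.
  split; first by exists (complex.Re a); exact: AB.
  exists (complex.Re b) => r /bA; case: b {bA} => b1 b2.
  by rewrite lecE /= => /andP[].
exists ((sup B)%:C)%C; split => [x Ax|y yA].
  rewrite lecE /= (ImA _ Ax) eqxx /=.
  by apply: (ub_le_sup (proj2 supB)); exact: AB.
have := yA _ Aa; rewrite !lecE /= (ImA _ Aa) => /andP[-> _] /=.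
apply: ge_sup (proj1 supB) _ => r /yA; rewrite lecE /= => /andP[_].
exact.
Qed.

HB.instance Definition _ :=
  NumField_hasRealSup.Build R[i] complex_has_supremums.

End scalar_instances.

Section dual_space.
Variables (K : scalarFieldType) (E : normedModType K).

(* K^o is K seen as a normed module over itself. *)
Definition bounded_functional (f : E -> K^o) : Prop :=
  linear f /\ exists M : K, forall x, `|f x| <= M * `|x|.

Definition dual_pred : {pred E -> K^o} :=
  [pred f | `[< bounded_functional f >]].

Record dual := Dual {
  dual_fun :> E -> K^o;
  dual_funP : dual_fun \in dual_pred
}.

HB.instance Definition _ := [isSub for dual_fun].
HB.instance Definition _ := [Choice of dual by <:].

Fact dual_submod_closed :
  submod_closed dual_pred.
Proof.
split=> [|a f g /asboolP[lf [M fM]] /asboolP[lg [N gN]]]; apply/asboolP.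
  split; first by move=> k x y; rewrite [RHS]addr0 [RHS]scaler0.
  by exists 0 => x; rewrite mul0r normr0.
have afgE x : (a *: f + g) x = a *: f x + g x by [].
split=> [k x y|].
  rewrite !afgE lf lg !scalerDr !scalerA (mulrC a k) -!addrA; congr +%R.
  by rewrite addrCA.
exists (`|a| * M + N) => x; rewrite afgE mulrDl -mulrA.
by rewrite (le_trans (ler_normD _ _)) // lerD // normrZ ler_wpM2l.
Qed.

HB.instance Definition _ := GRing.isSubmodClosed.Build K (E -> K^o)
  dual_pred dual_submod_closed.
HB.instance Definition _ := [SubChoice_isSubLmodule of dual by <:].

Lemma dual_boundedP (f : dual) : bounded_functional f.
Proof. exact/asboolP/(dual_funP f). Qed.

Lemma dual_linear (f : dual) : linear f.
Proof. exact: (dual_boundedP f).1. Qed.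

Lemma dualDE (f g : dual) x : (f + g) x = f x + g x.
Proof. by []. Qed.

Lemma dualZE a (f : dual) x : (a *: f) x = a *: f x.
Proof. by []. Qed.

Lemma dual_eqP (f g : dual) : f =1 g -> f = g.
Proof. by move=> fg; apply: val_inj; apply/funext. Qed.

(* The supremum is taken in the order of K, and the norm is thus a nonnegative
   element of K; dual_norm_supremums
   shows that it is a genuine least upper bound. *)
Definition dual_norm (f : dual) : K :=
  supremum 0 [set `|f x| | x in [set x : E | `|x| <= 1]].

Lemma dual0r (f : dual) : f 0 = 0.
Proof.
by have := dual_linear f (-1) 0 0; rewrite scaler0 addr0 scaleN1r addNr.
Qed.

Lemma dualZr (f : dual) a x : f (a *: x) = a *: f x.
Proof. by have := dual_linear f a x 0; rewrite dual0r !addr0. Qed.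

Lemma dual_norm_supremums (f : dual) :
  supremums [set `|f x| | x in [set x : E | `|x| <= 1]] (dual_norm f).
Proof.
have [_ [M fM]] := dual_boundedP f.
rewrite /dual_norm /supremum; case: ifPn => [/eqP A0|_].
  have : [set `|f x| | x in [set x : E | `|x| <= 1]] `|f 0|.
    by exists 0 => //=; rewrite normr0.
  by rewrite A0.
apply: xgetPex; apply: real_has_supremums.
  by move=> _ [x _ <-]; rewrite normr_real.
split; first by exists `|f 0|, 0 => //=; rewrite normr0.
exists `|M| => _ [x /= x1 <-].
rewrite -normr_id (le_trans (y := `|M * `|x| |))//.
  rewrite ger0_norm // [leRHS]ger0_norm; first exact: fM.
  exact: le_trans (fM x).
by rewrite normrM normr_id ler_piMr.
Qed.

Lemma dual_norm_ge0 (f : dual) : 0 <= dual_norm f.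
Proof.
have [/(_ `|f 0|) + _] := dual_norm_supremums f; rewrite dual0r normr0; apply.
by exists 0; rewrite /= ?normr0 // dual0r normr0.
Qed.

Lemma ler_dual_norm (f : dual) x : `|f x| <= dual_norm f * `|x|.
Proof.
have [->|x0] := eqVneq x 0; first by rewrite dual0r !normr0 mulr0.
rewrite -ler_pdivrMr ?normr_gt0 //.
have [ub _] := dual_norm_supremums f; apply: ub.
exists (`|x|^-1 *: x); last by rewrite dualZr normrZ normfV normr_id mulrC.
by rewrite /= normrZ normfV normr_id mulVf // normr_eq0.
Qed.

Lemma dual_norm_le (f : dual) (M : K) :
  0 <= M -> (forall x, `|f x| <= M * `|x|) -> dual_norm f <= M.
Proof.
move=> M0 fM; have [_ lb] := dual_norm_supremums f; apply: lb.
by move=> _ [x /= x1 <-]; rewrite (le_trans (fM x)) // ler_piMr.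
Qed.

Fact dual_normD (f g : dual) : dual_norm (f + g) <= dual_norm f + dual_norm g.
Proof.
apply: dual_norm_le => [|x]; first by rewrite addr_ge0 ?dual_norm_ge0.
rewrite mulrDl (le_trans (ler_normD _ _)) // lerD //; exact: ler_dual_norm.
Qed.

Let dual_normZ_le a (f : dual) : dual_norm (a *: f) <= `|a| * dual_norm f.
Proof.
apply: dual_norm_le => [|x]; first by rewrite mulr_ge0 ?dual_norm_ge0.
by rewrite dualZE normrZ -mulrA ler_wpM2l // ler_dual_norm.
Qed.

Fact dual_normZ a (f : dual) : dual_norm (a *: f) = `|a| * dual_norm f.
Proof.
apply/eqP; rewrite eq_le dual_normZ_le /=.
have [->|a0] := eqVneq a 0; first by rewrite normr0 mul0r dual_norm_ge0.
have := dual_normZ_le a^-1 (a *: f).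
rewrite scalerA mulVf // scale1r normfV mulrC.
by rewrite ler_pdivlMr ?normr_gt0 // mulrC.
Qed.

Fact dual_norm0_eq0 (f : dual) : dual_norm f = 0 -> f = 0.
Proof.
move=> f0; apply: dual_eqP => x; apply/eqP; rewrite -normr_le0.
by rewrite (le_trans (ler_dual_norm f x)) // f0 mul0r.
Qed.

HB.instance Definition _ :=
  Lmodule_isNormed.Build K dual dual_normD dual_normZ dual_norm0_eq0.

Lemma dual_normE (f : dual) : `|f| = dual_norm f. Proof. by []. Qed.

End dual_space.

Section multilinear_maps.
Variable K : numFieldType.
Implicit Types E : normedModType K.

Definition bounded_bilinear E1 E2 E (m : E1 -> E2 -> E) : Prop :=
  [/\ forall y, linear (fun x => m x y),
      forall x, linear (fun y => m x y) &
      exists M : K, forall x y, `|m x y| <= M * `|x| * `|y|].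

Record bilinear_map E1 E2 E := BilinearMap {
  bilinear_fun :> E1 -> E2 -> E;
  bilinear_mapP : bounded_bilinear bilinear_fun
}.

Definition bounded_trilinear E1 E2 E3 E (g : E1 -> E2 -> E3 -> E) : Prop :=
  [/\ forall y z, linear (fun x => g x y z),
      forall x z, linear (fun y => g x y z),
      forall x y, linear (fun z => g x y z) &
      exists M : K, forall x y z, `|g x y z| <= M * `|x| * `|y| * `|z|].

Record trilinear_map E1 E2 E3 E := TrilinearMap {
  trilinear_fun :> E1 -> E2 -> E3 -> E;
  trilinear_mapP : bounded_trilinear trilinear_fun
}.

Fact bound_nonneg (M a b : K) : 0 <= a -> 0 <= b -> a <= M * b -> a <= `|M| * b.
Proof.
by move=> a0 b0 aM; rewrite -(ger0_norm b0) -normrM ger0_norm // (le_trans a0).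
Qed.

Lemma bilinear_bound E1 E2 E (m : bilinear_map E1 E2 E) :
  exists2 M : K, 0 <= M & forall x y, `|m x y| <= M * `|x| * `|y|.
Proof.
have [_ _ [M mM]] := bilinear_mapP m; exists `|M| => // x y.
by rewrite -mulrA bound_nonneg ?mulr_ge0 // mulrA.
Qed.

Lemma trilinear_bound E1 E2 E3 E (g : trilinear_map E1 E2 E3 E) :
  exists2 M : K, 0 <= M & forall x y z, `|g x y z| <= M * `|x| * `|y| * `|z|.
Proof.
have [_ _ _ [M gM]] := trilinear_mapP g; exists `|M| => // x y z.
by rewrite -2!mulrA bound_nonneg ?mulr_ge0 // !mulrA.
Qed.

Fact flip_subproof E1 E2 E (m : bilinear_map E1 E2 E) :
  bounded_bilinear (fun y x => m x y).
Proof.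
have [m1 m2 [M mM]] := bilinear_mapP m; split => //.
by exists M => y x; rewrite mulrAC.
Qed.

Definition flip_r E1 E2 E (m : bilinear_map E1 E2 E) : bilinear_map E2 E1 E :=
  BilinearMap (flip_subproof m).

Fact flip_t_subproof E1 E2 E3 E (g : trilinear_map E1 E2 E3 E) :
  bounded_trilinear (fun z x y => g x y z).
Proof.
have [g1 g2 g3 [M gM]] := trilinear_mapP g; split => //.
by exists M => z x y; rewrite [M * `|z| * _]mulrAC [leRHS]mulrAC.
Qed.

Definition flip_t E1 E2 E3 E (g : trilinear_map E1 E2 E3 E) :
  trilinear_map E3 E1 E2 E := TrilinearMap (flip_t_subproof g).

Fact flip_s_subproof E1 E2 E3 E (g : trilinear_map E1 E2 E3 E) :
  bounded_trilinear (fun y z x => g x y z).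
Proof.
have [g1 g2 g3 [M gM]] := trilinear_mapP g; split => //.
by exists M => y z x; rewrite [leRHS]mulrAC [M * `|y| * _]mulrAC.
Qed.

Definition flip_s E1 E2 E3 E (g : trilinear_map E1 E2 E3 E) :
  trilinear_map E2 E3 E1 E := TrilinearMap (flip_s_subproof g).

End multilinear_maps.

Section adjoints.
Variable K : scalarFieldType.
Implicit Types E : normedModType K.

Fact adj2_fun_subproof E1 E2 E (m : bilinear_map E1 E2 E) (e' : dual E) e1 :
  (fun e2 => e' (m e1 e2)) \in @dual_pred K E2.
Proof.
have [m1 m2 _] := bilinear_mapP m; have [M M0 mM] := bilinear_bound m.
apply/asboolP; split; first by move=> a x y; rewrite m2 dual_linear.
exists (dual_norm e' * (M * `|e1|)) => x.
by rewrite (le_trans (ler_dual_norm _ _)) // -mulrA ler_wpM2l // dual_norm_ge0.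
Qed.

Definition adj2_fun E1 E2 E (m : bilinear_map E1 E2 E) (e' : dual E) (e1 : E1) :
  dual E2 := Dual (adj2_fun_subproof m e' e1).

Fact adj2_subproof E1 E2 E (m : bilinear_map E1 E2 E) :
  bounded_bilinear (adj2_fun m).
Proof.
have [m1 m2 _] := bilinear_mapP m; have [M M0 mM] := bilinear_bound m.
split.
- by move=> e1 a x y; exact: dual_eqP.
- by move=> e' a x y; apply: dual_eqP => e2; rewrite /= m1 dual_linear.
exists M => e' e1; apply: dual_norm_le.
  by rewrite !mulr_ge0 // dual_norm_ge0.
move=> x; apply: le_trans (ler_dual_norm e' (m e1 x)) _.
apply: le_trans (ler_wpM2l (dual_norm_ge0 e') (mM e1 x)) _.
by rewrite !mulrA [_ * M]mulrC.
Qed.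

Definition adj2 E1 E2 E (m : bilinear_map E1 E2 E) :
  bilinear_map (dual E) E1 (dual E2) := BilinearMap (adj2_subproof m).

Lemma adj2E E1 E2 E (m : bilinear_map E1 E2 E) e' e1 e2 :
  adj2 m e' e1 e2 = e' (m e1 e2).
Proof. by []. Qed.

Fact adj3_fun_subproof E1 E2 E3 E (g : trilinear_map E1 E2 E3 E)
    (e' : dual E) e1 e2 :
  (fun e3 => e' (g e1 e2 e3)) \in @dual_pred K E3.
Proof.
have [g1 g2 g3 _] := trilinear_mapP g; have [M M0 gM] := trilinear_bound g.
apply/asboolP; split; first by move=> a x y; rewrite g3 dual_linear.
exists (dual_norm e' * (M * `|e1| * `|e2|)) => x.
by rewrite (le_trans (ler_dual_norm _ _)) // -mulrA ler_wpM2l // dual_norm_ge0.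
Qed.

Definition adj3_fun E1 E2 E3 E (g : trilinear_map E1 E2 E3 E)
    (e' : dual E) (e1 : E1) (e2 : E2) : dual E3 :=
  Dual (adj3_fun_subproof g e' e1 e2).

Fact adj3_subproof E1 E2 E3 E (g : trilinear_map E1 E2 E3 E) :
  bounded_trilinear (adj3_fun g).
Proof.
have [g1 g2 g3 _] := trilinear_mapP g; have [M M0 gM] := trilinear_bound g.
split.
- by move=> e1 e2 a x y; exact: dual_eqP.
- by move=> e' e2 a x y; apply: dual_eqP => e3; rewrite /= g1 dual_linear.
- by move=> e' e1 a x y; apply: dual_eqP => e3; rewrite /= g2 dual_linear.
exists M => e' e1 e2; apply: dual_norm_le.
  by rewrite !mulr_ge0 // dual_norm_ge0.
move=> x; apply: le_trans (ler_dual_norm e' (g e1 e2 x)) _.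
apply: le_trans (ler_wpM2l (dual_norm_ge0 e') (gM e1 e2 x)) _.
by rewrite !mulrA [_ * M]mulrC.
Qed.

Definition adj3 E1 E2 E3 E (g : trilinear_map E1 E2 E3 E) :
  trilinear_map (dual E) E1 E2 (dual E3) := TrilinearMap (adj3_subproof g).

Lemma adj3E E1 E2 E3 E (g : trilinear_map E1 E2 E3 E) e' e1 e2 e3 :
  adj3 g e' e1 e2 e3 = e' (g e1 e2 e3).
Proof. by []. Qed.

Definition bidual E : normedModType K := dual (dual E).

Definition arens_ext2 E1 E2 E (m : bilinear_map E1 E2 E) :
  bilinear_map (bidual E1) (bidual E2) (bidual E) := adj2 (adj2 (adj2 m)).

Definition arens_ext3 E1 E2 E3 E (g : trilinear_map E1 E2 E3 E) :
  trilinear_map (bidual E1) (bidual E2) (bidual E3) (bidual E) :=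
  adj3 (adj3 (adj3 (adj3 g))).

Definition arens_regular E1 E2 E (m : bilinear_map E1 E2 E) : Prop :=
  forall (e1 : bidual E1) (e2 : bidual E2),
    arens_ext2 m e1 e2 = flip_r (arens_ext2 (flip_r m)) e1 e2.

Definition close_to_regular X Y Z W (f : trilinear_map X Y Z W) : Prop :=
  forall (x : bidual X) (y : bidual Y) (z : bidual Z),
    flip_s (arens_ext3 (flip_t f)) x y z = flip_t (arens_ext3 (flip_s f)) x y z.

End adjoints.

(* Main.v *)
Require Import Defs.
From mathcomp Require Import all_boot all_order all_algebra.
From mathcomp Require Import all_classical topology normedtype.

(** Write [x''(x |-> phi x)] for the value of a bidual element at the functional
    [phi], and let [F x y z = <w, f x y z>].  Unfolding the iterated adjoints,
    each extension evaluates the biduals one variable at a time, in an order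
    that depends on the flips:
    - the two sides of close-to-regularity, paired with [w], are
      [z''(z |-> x''(x |-> y''(y |-> F x y z)))] and
      [y''(y |-> z''(z |-> x''(x |-> F x y z)))];
    - the two Arens extensions of [m], paired with [x''], are
      [y''(y |-> z''(z |-> x''(x |-> F x y z)))] and
      [z''(z |-> y''(y |-> x''(x |-> F x y z)))].

    With orders of evaluation read from the outside in, the hypothesis is
    [zxy = yzx] and the goal is [yzx = zyx].  Taking for [z''] the evaluation
    at a point [z] in the hypothesis removes the variable [z] and leaves
    [xy = yx] for each fixed [z] (lemma [evaluation_orders_agree_at_point]).
    Applying an arbitrary [z''] to this equality of functionals of [z] gives
    [zxy = zyx], and hence [yzx = zxy = zyx]. *)

Import GRing.Theory.
Local Open Scope ring_scope.

Fact point_evaluation_subproof (K : scalarFieldType) (E : normedModType K)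
    (e : E) : (fun phi : dual E => phi e) \in @dual_pred K (dual E).
Proof.
apply/asboolP; split => //.
by exists `|e| => phi; rewrite mulrC dual_normE; exact: ler_dual_norm.
Qed.

Definition point_evaluation (K : scalarFieldType) (E : normedModType K)
    (e : E) : bidual E := Dual (point_evaluation_subproof K E e).

(** The equality is close-to-regularity at [z'' = point_evaluation z]: whichever
    position [z''] occupies, it only substitutes [z]. *)
Lemma evaluation_orders_agree_at_point (K : scalarFieldType)
    (X Y Z W : normedModType K) (f : trilinear_map X Y Z W) (w : dual W)
    (m : bilinear_map Y Z (dual X)) (x : bidual X) (y : bidual Y) (z : Z) :
  (forall (y : Y) (z : Z), m y z = adj3 (flip_s f) w y z) ->
  close_to_regular f ->
  x (adj3 (adj3 (flip_t f)) y w z) = y (adj2 (flip_r m) x z).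
Proof.
move=> mE /(_ x y (point_evaluation K Z z)) /(congr1 (fun u : bidual W => u w)).
move=> /= ->; congr (y _); apply: dual_eqP => y0 /=.
by rewrite mE.
Qed.

Theorem theorem5 (K : scalarFieldType) (X Y Z W : normedModType K)
    (f : trilinear_map X Y Z W) (w : dual W) (m : bilinear_map Y Z (dual X)) :
  (forall (y : Y) (z : Z), m y z = adj3 (flip_s f) w y z) ->
  close_to_regular f -> arens_regular m.
Proof.
move=> mE fcr y z; apply: dual_eqP => x.
transitivity (arens_ext3 (flip_s f) y z x w).
  (* both sides evaluate in the order yzx, since m is the slice of f at w *)
  congr (y _); apply: dual_eqP => y0; congr (z _); apply: dual_eqP => z0 /=.
  by rewrite mE.
transitivity (arens_ext3 (flip_t f) z x y w).
  exact: (congr1 (fun u : bidual W => u w) (esym (fcr x y z))).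
congr (z _); apply: dual_eqP => z0.
exact: evaluation_orders_agree_at_point.
Qed.
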